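(* Let $\mathcal L$ be the generator of a primitive quantum Markov semigroup satisfying the $\sigma$-KMS detailed balance condition for its full-rank invariant state $\sigma$. For $p\in(0,1)\cup(1,\infty)$ let $\alpha_p(\mathcal L)$ and $\widetilde\beta_p(\mathcal L)$ be the optimal constants in the $p$-Beckner inequality and in the $p$-log-Sobolev inequality, respectively. Then $$p\,\alpha_p(\mathcal L)\ge\widetilde\beta_p(\mathcal L)\ \text{ for } p>1,\qquad p\,\alpha_p(\mathcal L)\le\widetilde\beta_p(\mathcal L)\ \text{ for } 0<p<1 .$$
   Context: $\mathcal H$ is a finite-dimensional Hilbert space, $\mathcal B(\mathcal H)$ the operators on it. A quantum Markov semigroup (QMS) is a $C_0$-semigroup $(\mathcal P_t)_{t\ge0}$ of completely positive unital maps on $\mathcal B(\mathcal H)$, with generator $\mathcal L$; $\dagger$ is the adjoint for the Hilbert–Schmidt inner product. It is primitive if it has a unique invariant state $\sigma$ ($\mathcal P_t^\dagger(\sigma)=\sigma$ for all $t$) and $\sigma$ has full rank. The $\sigma$-KMS detailed balance condition means that $\mathcal L$ is self-adjoint for $\langle X,Y\rangle_{\sigma,1/2}=\mathrm{Tr}(\sigma^{1/2}X^*\sigma^{1/2}Y)$. Let $\Gamma_\sigma^{s}(X)=\sigma^{s/2}X\sigma^{s/2}$ for $s\in\mathbb R$, $\|X\|_{p,\sigma}=\mathrm{Tr}\big(|\Gamma_\sigma^{1/p}(X)|^p\big)^{1/p}$, $\hat p=p/(p-1)$. For $X>0$, $$\mathcal E_{p,\mathcal L}(X)=-\frac{\hat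 p\,p}{4}\Big\langle \Gamma_\sigma^{-1/\hat p}\big((\Gamma_\sigma^{1/p}(X))^{p-1}\big),\mathcal L(X)\Big\rangle_{\sigma,1/2},$$ $$\mathrm{Ent}_{p,\sigma}(X)=\mathrm{Tr}\Big((\Gamma_\sigma^{1/p}(X))^p\big(\log(\Gamma_\sigma^{1/p}(X))^p-\log\sigma\big)\Big)-\|X\|_{p,\sigma}^p\log\|X\|_{p,\sigma}^p .$$ The $p$-Beckner inequality with constant $\alpha_p$ is $\alpha_p\,\hat p\,(\|X\|_{p,\sigma}^p-\|X\|_{1,\sigma}^p)\le\mathcal E_{p,\mathcal L}(X)$ for all $X>0$; the $p$-log-Sobolev inequality with constant $\widetilde\beta_p$ is $\widetilde\beta_p\,\mathrm{Ent}_{p,\sigma}(X)\le\mathcal E_{p,\mathcal L}(X)$ for all $X>0$. The optimal constant is the largest nonnegative constant for which the inequality holds. *)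

(* Defs.v *)
From HB Require Import structures.
From mathcomp Require Import all_boot all_order all_algebra.
From mathcomp Require Import complex.
From mathcomp Require Import all_classical all_reals all_analysis.

Set Implicit Arguments.
Unset Strict Implicit.
Unset Printing Implicit Defensive.

Import Order.TTheory GRing.Theory Num.Theory numFieldNormedType.Exports.

Local Open Scope classical_set_scope.
Local Open Scope ring_scope.
Local Open Scope complex_scope.
Local Open Scope sesquilinear_scope.

(* The n-dimensional Hilbert space is C^n with C = R[i], and its operators are
   'M[R[i]]_n; A ^t* is the adjoint of A. *)

(* Nonreal elements of R[i] are comparable to no real one, so both notions
   below force A to be Hermitian. *)
Definition possemidef (R : realType) (n : nat) (A : 'M[R[i]]_n) : Prop :=
  forall v : 'cV[R[i]]_n, 0 <= (v ^t* *m A *m v) 0 0.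

Definition posdef (R : realType) (n : nat) (A : 'M[R[i]]_n) : Prop :=
  forall v : 'cV[R[i]]_n, v != 0 -> 0 < (v ^t* *m A *m v) 0 0.

(* Functional calculus through the unitary diagonalization of the spectral
   theorem; meaningful for Hermitian A, whose spectral_diag is real. *)
Definition mxfun (R : realType) (n : nat) (f : R -> R) (A : 'M[R[i]]_n) :
    'M[R[i]]_n :=
  invmx (spectralmx A)
    *m diag_mx (map_mx (fun z => (f (complex.Re z))%:C) (spectral_diag A))
    *m spectralmx A.

Definition mxpow (R : realType) (n : nat) (A : 'M[R[i]]_n) (s : R) :
  'M[R[i]]_n := mxfun (fun x => x `^ s) A.

Definition mxln (R : realType) (n : nat) (A : 'M[R[i]]_n) : 'M[R[i]]_n :=
  mxfun (@ln R) A.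

Definition mxabs (R : realType) (n : nat) (A : 'M[R[i]]_n) : 'M[R[i]]_n :=
  mxpow (A ^t* *m A) (1 / 2).

(* id_k (x) F preserves positivity for every k, an element of
   M_k (x) M_n being a k x k matrix of n x n blocks. *)
Definition completely_positive (R : realType) (n : nat)
    (F : 'M[R[i]]_n -> 'M[R[i]]_n) : Prop :=
  forall (k : nat) (A : 'M[R[i]]_(\sum_(i < k) n)),
    possemidef A ->
    possemidef (\mxblock_(i < k, j < k) F (submxblock A i j)).

(* R[i]^o is R[i] with its topology of normed field. *)
Definition quantum_Markov_semigroup (R : realType) (n : nat)
    (P : R -> {linear 'M[R[i]]_n -> 'M[R[i]]_n}) : Prop :=
  [/\ forall X, P 0 X = X,
      forall s t X, 0 <= s -> 0 <= t -> P (s + t) X = P s (P t X),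
      forall X, (P t X : 'M[R[i]^o]_n) @[t --> 0^'+] --> (X : 'M[R[i]^o]_n),
      forall t, 0 <= t -> completely_positive (P t)
    & forall t, 0 <= t -> P t 1%:M = 1%:M].

Definition is_generator (R : realType) (n : nat)
    (P : R -> {linear 'M[R[i]]_n -> 'M[R[i]]_n})
    (L : {linear 'M[R[i]]_n -> 'M[R[i]]_n}) : Prop :=
  forall X, ((t^-1)%:C *: (P t X - X) : 'M[R[i]^o]_n) @[t --> 0^'+]
            --> (L X : 'M[R[i]^o]_n).

Definition hs_dot (R : realType) (n : nat) (X Y : 'M[R[i]]_n) : R[i] :=
  \tr (X ^t* *m Y).

(* The (i, j) entry is the Hilbert-Schmidt product with the matrix unit
   delta_mx i j, see hs_adjP. *)
Definition hs_adj (R : realType) (n : nat) (F : 'M[R[i]]_n -> 'M[R[i]]_n)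
    (Y : 'M[R[i]]_n) : 'M[R[i]]_n :=
  \matrix_(i, j) hs_dot (F (delta_mx i j)) Y.

Lemma hs_adjP (R : realType) (n : nat)
    (F : {linear 'M[R[i]]_n -> 'M[R[i]]_n}) (X Y : 'M[R[i]]_n) :
  hs_dot (F X) Y = hs_dot X (hs_adj F Y).
Proof.
have dotE (A B : 'M[R[i]]_n) :
    hs_dot A B = \sum_i \sum_j (A i j)^* * B i j.
  rewrite /hs_dot /mxtrace exchange_big /=; apply: eq_bigr => j _.
  by rewrite !mxE; apply: eq_bigr => i _; rewrite !mxE.
have dotD : {morph (fun A => hs_dot A Y) : A B / A + B}.
  by move=> A B; rewrite /hs_dot linearD map_mxD mulmxDl linearD.
have dot0 : hs_dot (0 : 'M[R[i]]_n) Y = 0 by rewrite /hs_dot linear0 map_mx0 mul0mx linear0.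
have dotZ c A : hs_dot (c *: A) Y = c^* * hs_dot A Y.
  by rewrite /hs_dot linearZ map_mxZ -scalemxAl linearZ.
rewrite {1}[X]matrix_sum_delta linear_sum (big_morph _ dotD dot0) dotE.
apply: eq_bigr => i _; rewrite linear_sum (big_morph _ dotD dot0).
by apply: eq_bigr => j _; rewrite linearZ dotZ mxE.
Qed.

Definition state (R : realType) (n : nat) (rho : 'M[R[i]]_n) : Prop :=
  possemidef rho /\ \tr rho = 1.

Definition invariant_state (R : realType) (n : nat)
    (P : R -> {linear 'M[R[i]]_n -> 'M[R[i]]_n}) (rho : 'M[R[i]]_n) : Prop :=
  state rho /\ forall t, 0 <= t -> hs_adj (P t) rho = rho.

Definition primitive_with (R : realType) (n : nat)
    (P : R -> {linear 'M[R[i]]_n -> 'M[R[i]]_n}) (sigma : 'M[R[i]]_n) : Prop :=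
  [/\ invariant_state P sigma,
      forall rho, invariant_state P rho -> rho = sigma
    & \rank sigma = n].

Definition kms_dot (R : realType) (n : nat) (sigma X Y : 'M[R[i]]_n) : R[i] :=
  \tr (mxpow sigma (1 / 2) *m X ^t* *m mxpow sigma (1 / 2) *m Y).

Definition kms_detailed_balance (R : realType) (n : nat)
    (sigma : 'M[R[i]]_n) (L : 'M[R[i]]_n -> 'M[R[i]]_n) : Prop :=
  forall X Y, kms_dot sigma (L X) Y = kms_dot sigma X (L Y).

Definition Gam (R : realType) (n : nat) (sigma : 'M[R[i]]_n) (s : R)
    (X : 'M[R[i]]_n) : 'M[R[i]]_n :=
  mxpow sigma (s / 2) *m X *m mxpow sigma (s / 2).

(* Here, in dirichlet and in Ent, complex.Re is applied to numbers that are
   real for X positive definite and L Hermitian-preserving. *)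
Definition normp (R : realType) (n : nat) (sigma : 'M[R[i]]_n) (p : R)
    (X : 'M[R[i]]_n) : R :=
  complex.Re (\tr (mxpow (mxabs (Gam sigma p^-1 X)) p)) `^ p^-1.

Definition hconj (R : realType) (p : R) : R := p / (p - 1).

Definition dirichlet (R : realType) (n : nat) (sigma : 'M[R[i]]_n)
    (L : 'M[R[i]]_n -> 'M[R[i]]_n) (p : R) (X : 'M[R[i]]_n) : R :=
  - (hconj p * p / 4)
  * complex.Re (kms_dot sigma
      (Gam sigma (- (hconj p)^-1) (mxpow (Gam sigma p^-1 X) (p - 1))) (L X)).

Definition Ent (R : realType) (n : nat) (sigma : 'M[R[i]]_n) (p : R)
    (X : 'M[R[i]]_n) : R :=
  let Y := mxpow (Gam sigma p^-1 X) p in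
  complex.Re (\tr (Y *m (mxln Y - mxln sigma)))
  - normp sigma p X `^ p * ln (normp sigma p X `^ p).

Definition beckner (R : realType) (n : nat) (sigma : 'M[R[i]]_n)
    (L : 'M[R[i]]_n -> 'M[R[i]]_n) (p alpha : R) : Prop :=
  forall X, posdef X ->
    alpha * hconj p * (normp sigma p X `^ p - normp sigma 1 X `^ p)
    <= dirichlet sigma L p X.

Definition log_sobolev (R : realType) (n : nat) (sigma : 'M[R[i]]_n)
    (L : 'M[R[i]]_n -> 'M[R[i]]_n) (p beta : R) : Prop :=
  forall X, posdef X -> beta * Ent sigma p X <= dirichlet sigma L p X.

(* The value is extended real because, for n = 1, every constant is
   admissible and there is no largest one. It is -oo if no nonnegative
   constant is admissible. *)
Definition optimal_constant (R : realType) (S : R -> Prop) : \bar R :=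
  ereal_sup [set c%:E | c in [set c : R | 0 <= c /\ S c]].

Lemma optimal_constant_largest (R : realType) (S : R -> Prop) (c : R) :
  0 <= c -> S c -> (forall d, 0 <= d -> S d -> d <= c) ->
  optimal_constant S = c%:E.
Proof.
move=> c0 Sc cmax; apply/eqP; rewrite eq_le; apply/andP; split.
  by apply: ge_ereal_sup => _ [d [d0 Sd] <-]; rewrite lee_fin cmax.
by apply: ereal_sup_ubound; exists c.
Qed.

Definition alpha_opt (R : realType) (n : nat) (sigma : 'M[R[i]]_n)
    (L : 'M[R[i]]_n -> 'M[R[i]]_n) (p : R) : \bar R :=
  optimal_constant (beckner sigma L p).

Definition beta_opt (R : realType) (n : nat) (sigma : 'M[R[i]]_n)
    (L : 'M[R[i]]_n -> 'M[R[i]]_n) (p : R) : \bar R :=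
  optimal_constant (log_sobolev sigma L p).

(* Main.v *)
Require Import Defs.
From HB Require Import structures.
From mathcomp Require Import all_boot all_order all_algebra.
From mathcomp Require Import complex.
From mathcomp Require Import all_classical all_reals all_analysis.
From mathcomp Require Import ring lra.

Local Open Scope ring_scope.
Local Open Scope complex_scope.

(** The Dirichlet form is the same in both inequalities, so the constants can be
    compared through the left-hand sides alone. Everything follows from

      [||X||_p^p - ||X||_1^p <= (p - 1) * Ent_p (X)]

    for positive definite [X] ([normp_sub_le_Ent]). Dividing by [p - 1], whose
    sign decides the direction, compares [Ent_p] with
    [hconj p / p * (||X||_p^p - ||X||_1^p)]. So for
    [1 < p], if [b] is admissible in the log-Sobolev inequality then [b / p] is
    admissible in the Beckner inequality, and for [p < 1], if [a] is admissible
    in the Beckner inequality then [p * a] is admissible in the log-Sobolev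
    inequality; it remains to take suprema.

    For the displayed inequality put [G = Gam sigma p^-1 X] and [Y = G^p], so
    that [||X||_p^p = tr Y =: y], [||X||_1 = tr (Y^(1/p) sigma^(1 - 1/p)) =: Q]
    and [Ent_p (X) = tr (Y (ln Y - ln sigma)) - y ln y]. Here [Q] defines the
    Petz-Renyi divergence of order [1/p] of [Y] with respect to [sigma]. In
    eigenbases of [G] and of [sigma], with [w i j] the squared overlap of the
    [i]-th and [j]-th eigenvectors, all three traces are classical sums with
    weights [w] ([mxtrace_udiagM], [mxtrace_udiagMB]); the resulting inequality
    between sums is Jensen's inequality for the exponential
    ([hellinger_relative_entropy]). *)

Set Implicit Arguments.
Unset Strict Implicit.
Unset Printing Implicit Defensive.

Import Order.TTheory GRing.Theory Num.Theory.
Local Open Scope sesquilinear_scope.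

(** * The classical inequality *)

Section RenyiInequality.
Variables (R : realType) (n : nat).

Lemma tangent_expR (x x0 : R) : expR x0 * (1 + (x - x0)) <= expR x.
Proof.
rewrite -[x in leRHS](subrK x0) expRD [leRHS]mulrC.
by rewrite ler_pM2l ?expR_gt0 ?expR_ge1Dx.
Qed.

(** For the weights [w i j * g i `^ p], of total mass [y], and [w i j * s j],
    [Q] is the Hellinger integral of order [1/p] and [H] the relative entropy.
    When [y = 1] the lemma combines [1 - exp (- x) <= x] with the fact that
    the Renyi divergence of order [1/p] is at most the relative entropy when
    [1 < p], and at least the relative entropy when [p < 1]. Both cases have a
    single proof: multiplying by [1/p - 1] turns the two comparisons into the
    same instance of the convexity of [expR], used through its tangent at the
    mean [x0] of the exponents. *)
Lemma hellinger_relative_entropy (w : 'I_n -> 'I_n -> R) (g s : 'I_n -> R)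
    (p : R) :
  (forall i j, 0 <= w i j) -> (forall i, \sum_j w i j = 1) ->
  (forall i, 0 < g i) -> (forall j, 0 < s j) -> 0 < p ->
  let y := \sum_i g i `^ p in
  let Q := \sum_i \sum_j w i j * (g i * s j `^ (1 - p^-1)) in
  let H := \sum_i \sum_j w i j * (g i `^ p * (ln (g i `^ p) - ln (s j))) in
  0 < y -> y - Q `^ p <= (p - 1) * (H - y * ln y).
Proof.
move=> w0 w1 g0 s0 p0 y Q H y0.
have pN0 : p != 0 by rewrite gt_eqF.
have yN0 : y != 0 by rewrite gt_eqF.
pose x0 := (p^-1 - 1) * (H / y).
have massE : \sum_i \sum_j w i j * g i `^ p = y.
  by apply: eq_bigr => i _; rewrite -mulr_suml w1 mul1r.
(* The linear term of the tangent at [x0] has mean zero. *)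
have geQ : y * expR x0 <= Q.
  have -> : y * expR x0 = \sum_i \sum_j w i j * (g i `^ p * (expR x0 *
      (1 + ((p^-1 - 1) * (ln (g i `^ p) - ln (s j)) - x0)))).
    transitivity (expR x0 * ((1 - x0) * y + (p^-1 - 1) * H)).
      by rewrite /x0; field; rewrite pN0 yN0.
    rewrite -massE /H !mulr_sumr -big_split mulr_sumr /=.
    apply: eq_bigr => i _; rewrite !mulr_sumr -big_split mulr_sumr /=.
    by apply: eq_bigr => j _; ring.
  apply: ler_sum => i _; apply: ler_sum => j _.
  apply: ler_wpM2l => //.
  (* [g i * s j ^ (1 - 1/p)] is [g i ^ p] times the exponential of [1/p - 1]
     times the log-ratio. *)
  apply: (@le_trans _ _ (g i `^ p *
      expR ((p^-1 - 1) * (ln (g i `^ p) - ln (s j))))).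
    by rewrite ler_pM2l ?powR_gt0 ?tangent_expR.
  rewrite ln_powR /powR !gt_eqF // -expRD -[g i in leRHS]lnK ?posrE //.
  rewrite -expRD ler_expR le_eqVlt; apply/orP; left; apply/eqP.
  by field.
(* [Q ^ p] is increasing in [Q] as [0 < p], for either sign of [p - 1]. *)
have geQp : y * expR ((p - 1) * (ln y - H / y)) <= Q `^ p.
  have -> : y * expR ((p - 1) * (ln y - H / y)) = (y * expR x0) `^ p.
    rewrite powRM ?expR_ge0 ?(ltW y0) // -expRM.
    rewrite /powR gt_eqF // -expRD -[y in LHS]lnK ?posrE // -expRD.
    by congr expR; rewrite lnK ?posrE // /x0; field; rewrite pN0 yN0.
  by rewrite ge0_ler_powR ?nnegrE ?(ltW p0) ?mulr_ge0 ?expR_ge0 ?(ltW y0) //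
    (le_trans _ geQ) // mulr_ge0 ?expR_ge0 ?(ltW y0).
have := ler_wpM2l (ltW y0) (expR_ge1Dx ((p - 1) * (ln y - H / y))).
move=> /le_trans /(_ geQp).
have -> : y * (1 + (p - 1) * (ln y - H / y)) = y - (p - 1) * (H - y * ln y).
  by field.
lra.
Qed.

End RenyiInequality.

(** * Unitarily diagonalized matrices *)

Section UnitaryDiagonalization.
Variables (C : numClosedFieldType) (n : nat).
Implicit Types (A U V : 'M[C]_n) (D E : 'rV[C]_n).

Definition udiag U D : 'M[C]_n := U ^t* *m diag_mx D *m U.

Lemma adjmxM m k (M : 'M[C]_(m, n)) (N : 'M[C]_(n, k)) :
  (M *m N) ^t* = N ^t* *m M ^t*.
Proof. by rewrite trmx_mul map_mxM. Qed.

Lemma mulmx_sandwich (A B M : 'M[C]_n) :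
  B *m A *m M *m (A *m B) = B *m (A *m M *m A) *m B.
Proof. by rewrite !mulmxA. Qed.

Lemma mulVumx U : U \is unitarymx -> U ^t* *m U = 1%:M.
Proof. by move=> Uu; rewrite -invmx_unitary // mulVmx ?unitarymx_unit. Qed.

Lemma mulKumx U m (M : 'M[C]_(n, m)) : U \is unitarymx ->
  U ^t* *m (U *m M) = M.
Proof. by move=> Uu; rewrite mulmxA mulVumx ?mul1mx. Qed.

Lemma mulKVumx U m (M : 'M[C]_(n, m)) : U \is unitarymx ->
  U *m (U ^t* *m M) = M.
Proof. by move=> /unitarymxP Uu; rewrite mulmxA Uu mul1mx. Qed.

Lemma normal_udiag A : A \is normalmx ->
  A = udiag (spectralmx A) (spectral_diag A).
Proof.
move=> An; rewrite /udiag -invmx_unitary ?spectral_unitarymx //.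
exact: orthomx_spectralP.
Qed.

Lemma udiag_adj U D : (udiag U D) ^t* = udiag U (map_mx Num.conj D).
Proof.
by rewrite /udiag !adjmxM trmxCK mulmxA tr_diag_mx map_diag_mx.
Qed.

Lemma udiagM U D E : U \is unitarymx ->
  udiag U D *m udiag U E = udiag U (\row_i (D 0 i * E 0 i)).
Proof.
by move=> Uu; rewrite /udiag -!mulmxA mulKVumx // !mulmxA -mulmx_diag !mulmxA.
Qed.

Lemma udiag1 U : U \is unitarymx -> udiag U (const_mx 1) = 1%:M.
Proof. by move=> Uu; rewrite /udiag diag_const_mx mulmx1 mulVumx. Qed.

(** Functional calculus does not depend on the diagonalization. The change of
    basis [W] intertwines the two diagonal matrices, so [W i j] vanishes unless
    [D i = E j]; hence [W] also intertwines their images under [f]. *)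
Lemma udiag_fun (f : C -> C) U V D E :
  U \is unitarymx -> V \is unitarymx ->
  udiag U D = udiag V E -> udiag U (map_mx f D) = udiag V (map_mx f E).
Proof.
move=> Uu Vu UV; set W := U *m V ^t*.
have WV : U = W *m V by rewrite -mulmxA mulVumx // mulmx1.
have comm : diag_mx D *m W = W *m diag_mx E.
  transitivity (U *m udiag U D *m V ^t*).
    by rewrite /udiag -!mulmxA mulKVumx.
  by rewrite UV /udiag -!mulmxA (unitarymxP Vu) mulmx1 !mulmxA.
have commf : diag_mx (map_mx f D) *m W = W *m diag_mx (map_mx f E).
  move: W comm {WV} => W /matrixP comm; apply/matrixP=> i j; move: (comm i j).
  rewrite !mul_diag_mx !mul_mx_diag !mxE; have [->|Wij] := eqVneq (W i j) 0.
    by rewrite !mulr0 !mul0r.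
  by rewrite mulrC => /(mulfI Wij) ->; rewrite mulrC.
by rewrite /udiag [X in _ *m X]WV mulmxA -[_ *m _ *m W]mulmxA commf
  mulmxA mulKumx.
Qed.

Lemma udiag_eigenvector U D (i : 'I_n) : U \is unitarymx ->
  udiag U D *m (U ^t* *m delta_mx i (0 : 'I_1))
  = D 0 i *: (U ^t* *m delta_mx i (0 : 'I_1)).
Proof.
move=> Uu; rewrite /udiag -!mulmxA mulKVumx // scalemxAr; congr (_ *m _).
rewrite mul_diag_mx; apply/matrixP=> k l; rewrite !mxE.
by have [->|_] := eqVneq k i; rewrite ?mulr0.
Qed.

Lemma eigenvector_neq0 U (i : 'I_n) : U \is unitarymx ->
  U ^t* *m delta_mx i (0 : 'I_1) != 0.
Proof.
move=> Uu; apply/eqP => /(congr1 (mulmx U)); rewrite mulKVumx // mulmx0.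
by move/matrixP/(_ i 0); rewrite !mxE !eqxx => /eqP; rewrite oner_eq0.
Qed.

Lemma udiag_quadE U D (v : 'cV[C]_n) :
  (v ^t* *m udiag U D *m v) 0 0 = \sum_i D 0 i * `|(U *m v) i 0| ^+ 2.
Proof.
have -> : v ^t* *m udiag U D *m v = (U *m v) ^t* *m (diag_mx D *m (U *m v)).
  by rewrite adjmxM /udiag !mulmxA.
move: (U *m v) => w; rewrite mul_diag_mx mxE; apply: eq_bigr => i _.
by rewrite !mxE normCK mulrCA [_^* * _]mulrC.
Qed.

Lemma udiag_quad_eigenvector U D (i : 'I_n) : U \is unitarymx ->
  let v := U ^t* *m delta_mx i (0 : 'I_1) in
  (v ^t* *m udiag U D *m v) 0 0 = D 0 i.
Proof.
move=> Uu v; rewrite udiag_quadE mulKVumx // (bigD1 i) //= big1.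
  by rewrite mxE !eqxx normr1 expr1n mulr1 addr0.
by move=> j /negPf ji; rewrite mxE ji normr0 expr0n mulr0.
Qed.

(** [A - A^*] is anti-Hermitian, hence normal, and its quadratic form vanishes;
    evaluating that form at eigenvectors shows that all eigenvalues are zero. *)
Lemma real_quad_herm A :
  (forall v : 'cV[C]_n, (v ^t* *m A *m v) 0 0 \is Num.real) -> A ^t* = A.
Proof.
move=> Ar; apply/eqP; rewrite eq_sym -subr_eq0; apply/eqP; set B := A - A ^t*.
have adjB : B ^t* = - B by rewrite /B linearB map_mxB /= trmxCK opprB.
have /normal_udiag BE : B \is normalmx.
  by apply/normalmxP; rewrite adjB mulmxN mulNmx.
suff D0 : spectral_diag B = 0.
  by rewrite BE D0 /udiag (raddf0 (@diag_mx _ n)) mulmx0 mul0mx.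
apply/rowP=> i.
rewrite -(udiag_quad_eigenvector _ _ (spectral_unitarymx B)) -BE [RHS]mxE.
move: (_ *m delta_mx i 0) => v.
have quad_adj : (v ^t* *m A *m v) ^t* = v ^t* *m A ^t* *m v.
  by rewrite -[in RHS]mulmxA !adjmxM trmxCK.
rewrite /B mulmxBr mulmxBl -quad_adj !mxE conj_Creal ?subrr //.
by have := Ar v; rewrite mxE.
Qed.

Lemma mxtrace_udiag U D : U \is unitarymx -> \tr (udiag U D) = \sum_i D 0 i.
Proof. by move=> Uu; rewrite mxtrace_mulC mulKVumx // mxtrace_diag. Qed.

Lemma sum_sqr_unitary U V (i : 'I_n) : U \is unitarymx -> V \is unitarymx ->
  \sum_j `|(U *m V ^t*) i j| ^+ 2 = 1.
Proof.
move=> Uu Vu.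
have /unitarymxP : U *m V ^t* \is unitarymx.
  by rewrite mul_unitarymx // trmxC_unitary.
move: (U *m V ^t*) => W /matrixP/(_ i i).
rewrite mxE [RHS]mxE eqxx mulr1n => <-.
by apply: eq_bigr => j _; rewrite normCK !mxE.
Qed.

(** The squared overlaps of the eigenvectors serve as weights that turn traces
    of noncommuting matrices into classical sums over pairs of eigenvalues. *)
Lemma mxtrace_udiagM U V D E :
  \tr (udiag U D *m udiag V E)
  = \sum_i \sum_j `|(U *m V ^t*) i j| ^+ 2 * (D 0 i * E 0 j).
Proof.
have -> : \tr (udiag U D *m udiag V E) =
   \tr (diag_mx D *m ((U *m V ^t*) *m diag_mx E *m (U *m V ^t*) ^t*)).
  by rewrite /udiag adjmxM trmxCK -!mulmxA mxtrace_mulC -!mulmxA.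
move: (U *m V ^t*) => W; rewrite mul_diag_mx /mxtrace; apply: eq_bigr => i _.
rewrite mxE mxE mulr_sumr; apply: eq_bigr => j _.
by rewrite mul_mx_diag !mxE normCK; ring.
Qed.

(** The factors of the first product share their eigenvectors, so its trace is a
    single sum; the overlaps with a fixed [i] sum to one, which turns it into a
    double sum like the trace of the second product. *)
Lemma mxtrace_udiagMB U V D E F : U \is unitarymx -> V \is unitarymx ->
  \tr (udiag U D *m (udiag U E - udiag V F))
  = \sum_i \sum_j `|(U *m V ^t*) i j| ^+ 2 * (D 0 i * (E 0 i - F 0 j)).
Proof.
move=> Uu Vu; rewrite mulmxBr raddfB /= udiagM // mxtrace_udiag //.
rewrite mxtrace_udiagM -sumrB; apply: eq_bigr => i _.
rewrite mxE -[X in X - _]mul1r -(sum_sqr_unitary i Uu Vu) mulr_suml -sumrB.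
by apply: eq_bigr => j _; rewrite -mulrBr -mulrBr.
Qed.

End UnitaryDiagonalization.

(** * Powers and logarithms of positive definite matrices *)

Section FunctionalCalculus.
Variables (R : realType) (n : nat).
Implicit Types (A B U V : 'M[R[i]]_n) (d e : 'rV[R]_n).

Definition eigmx U d : 'M[R[i]]_n := udiag U (map_mx (real_complex R) d).

Lemma eigmx_adj U d : (eigmx U d) ^t* = eigmx U d.
Proof.
rewrite /eigmx udiag_adj; apply: (congr1 (udiag U)).
apply/rowP=> i; rewrite !mxE conj_Creal //.
by apply/complex_realP; exists (d 0 i).
Qed.

Lemma eigmxM U d e : U \is unitarymx ->
  eigmx U d *m eigmx U e = eigmx U (\row_i (d 0 i * e 0 i)).
Proof.
move=> Uu; rewrite /eigmx udiagM; last exact: Uu.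
by apply: (congr1 (udiag U)); apply/rowP=> i; rewrite !mxE rmorphM.
Qed.

Lemma eigmx1 U : U \is unitarymx -> eigmx U (const_mx 1) = 1%:M.
Proof.
by move=> Uu; rewrite -(udiag1 Uu) /eigmx map_const_mx rmorph1.
Qed.

Lemma mxfun_eigmx (f : R -> R) U d : U \is unitarymx ->
  mxfun f (eigmx U d) = eigmx U (map_mx f d).
Proof.
move=> Uu; set A := eigmx U d.
have An : A \is normalmx by apply/normalmxP; rewrite eigmx_adj.
have := udiag_fun (fun z => (f (complex.Re z))%:C)
  (spectral_unitarymx A) Uu (esym (normal_udiag An)).
have -> : map_mx (fun z => (f (complex.Re z))%:C) (map_mx (real_complex R) d)
    = map_mx (real_complex R) (map_mx f d).
  by apply/rowP=> i; rewrite !mxE.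
by rewrite /eigmx => <-; rewrite /udiag -(invmx_unitary (spectral_unitarymx A)).
Qed.

Lemma possemidef_herm A : possemidef A -> A ^t* = A.
Proof. by move=> A0; apply: real_quad_herm => v; apply: ger0_real (A0 v). Qed.

Lemma possemidef_eigmx A : possemidef A ->
  exists U d, [/\ U \is unitarymx, A = eigmx U d & forall i, 0 <= d 0 i].
Proof.
move=> A0; have An : A \is normalmx.
  by apply/normalmxP; rewrite (possemidef_herm A0).
have AE := normal_udiag An; have Uu := spectral_unitarymx A.
have D0 i : 0 <= spectral_diag A 0 i.
  by rewrite -(udiag_quad_eigenvector _ _ Uu) -AE; apply: A0.
exists (spectralmx A), (map_mx (@complex.Re R) (spectral_diag A)).
split; first exact: Uu.
  rewrite {1}AE /eigmx; apply: (congr1 (udiag _)).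
  by apply/rowP=> i; rewrite !mxE RRe_real // ger0_real.
by move=> i; rewrite mxE -ler0c RRe_real // ger0_real.
Qed.

Lemma posdef_possemidef A : posdef A -> possemidef A.
Proof.
move=> A0 v; have [->|v0] := eqVneq v 0; last exact: ltW (A0 v v0).
by rewrite mulmx0 mxE.
Qed.

Lemma posdef_eigmx A : posdef A ->
  exists U d, [/\ U \is unitarymx, A = eigmx U d & forall i, 0 < d 0 i].
Proof.
move=> A0; have [U [d [Uu AE _]]] := possemidef_eigmx (posdef_possemidef A0).
exists U, d; split=> // i; have := A0 _ (eigenvector_neq0 i Uu).
by rewrite AE udiag_quad_eigenvector // mxE ltcR.
Qed.

Lemma eigmx_posdef U d : U \is unitarymx -> (forall i, 0 < d 0 i) ->
  posdef (eigmx U d).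
Proof.
move=> Uu d0 v v0; rewrite udiag_quadE.
have ge0 i : 0 <= map_mx (real_complex R) d 0 i * `|(U *m v) i 0| ^+ 2.
  by rewrite mxE mulr_ge0 ?exprn_ge0 // ler0c ltW.
rewrite lt_def sumr_ge0 ?andbT; last by move=> i _.
apply: contra v0 => /eqP/psumr_eq0P w0.
rewrite -(mulKumx v Uu); suff -> : U *m v = 0 by rewrite mulmx0.
apply/matrixP=> i j; rewrite ord1 [RHS]mxE; apply/eqP.
have /eqP := w0 (fun i _ => ge0 i) i isT.
rewrite mulf_eq0 expf_eq0 /= normr_eq0 mxE => /orP[|//].
by rewrite (inj_eq (@complexI R)) gt_eqF.
Qed.

(** A zero eigenvalue would put an eigenvector in the kernel of [A]. *)
Lemma possemidef_full_rank A : possemidef A -> \rank A = n -> posdef A.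
Proof.
move=> A0 rA; have [U [d [Uu AE d0]]] := possemidef_eigmx A0.
rewrite AE; apply: eigmx_posdef => // i; rewrite lt_neqAle d0 andbT eq_sym.
apply: contraTneq isT => di0; have := eigenvector_neq0 i Uu.
have Aunit : A \in unitmx by rewrite -row_full_unit /row_full rA.
have := udiag_eigenvector (map_mx (real_complex R) d) i Uu.
rewrite -/(eigmx U d) -AE mxE di0 scale0r.
by move=> /(congr1 (mulmx (invmx A))); rewrite mulKmx // mulmx0 => -> /eqP.
Qed.

(** The left inverse [U] makes [B] injective. *)
Lemma posdef_congr A B U : posdef A -> U *m B = 1%:M ->
  posdef (B ^t* *m A *m B).
Proof.
move=> A0 UB v v0; have Bv0 : B *m v != 0.
  apply: contra v0 => /eqP /(congr1 (mulmx U)).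
  by rewrite mulmxA UB mul1mx mulmx0 => ->.
by have := A0 _ Bv0; rewrite adjmxM !mulmxA.
Qed.

Lemma mxpow_posdef A s : posdef A -> posdef (mxpow A s).
Proof.
move=> /posdef_eigmx[U [d [Uu -> d0]]].
rewrite /mxpow (mxfun_eigmx _ _ Uu); apply: eigmx_posdef => // i.
by rewrite mxE powR_gt0.
Qed.

Lemma mxpowD A s t : posdef A -> mxpow A (s + t) = mxpow A s *m mxpow A t.
Proof.
move=> /posdef_eigmx[U [d [Uu -> d0]]].
rewrite /mxpow !(mxfun_eigmx _ _ Uu) (eigmxM _ _ Uu); apply: (congr1 (eigmx U)).
by apply/rowP=> i; rewrite !mxE powRD //; apply/implyP=> _; rewrite gt_eqF.
Qed.

Lemma mxpow0 A : posdef A -> mxpow A 0 = 1%:M.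
Proof.
move=> /posdef_eigmx[U [d [Uu -> d0]]].
rewrite /mxpow (mxfun_eigmx _ _ Uu) -(eigmx1 Uu); apply: (congr1 (eigmx U)).
by apply/rowP=> i; rewrite !mxE powRr0.
Qed.

Lemma mxpow1 A : posdef A -> mxpow A 1 = A.
Proof.
move=> /posdef_eigmx[U [d [Uu -> d0]]].
rewrite /mxpow (mxfun_eigmx _ _ Uu); apply: (congr1 (eigmx U)).
by apply/rowP=> i; rewrite !mxE powRr1 // ltW.
Qed.

Lemma mxabs_posdef A : posdef A -> mxabs A = A.
Proof.
move=> /posdef_eigmx[U [d [Uu -> d0]]].
rewrite /mxabs eigmx_adj (eigmxM _ _ Uu) /mxpow (mxfun_eigmx _ _ Uu).
apply: (congr1 (eigmx U)).
apply/rowP=> i; rewrite !mxE div1r powR12_sqrt -?expr2 ?exprn_ge0 ?ltW //.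
by rewrite sqrtr_sqr gtr0_norm.
Qed.

Lemma Gam_posdef A B s : posdef A -> posdef B -> posdef (Gam A s B).
Proof.
move=> A0 B0; have As0 := posdef_possemidef (mxpow_posdef (s / 2) A0).
rewrite /Gam -{1}(possemidef_herm As0).
apply: posdef_congr (mxpow A (- (s / 2))) B0 _.
by rewrite -(mxpowD _ _ A0) addNr (mxpow0 A0).
Qed.

Lemma GamD A B s t : posdef A -> Gam A (s + t) B = Gam A t (Gam A s B).
Proof.
move=> A0; rewrite /Gam mulrDl {1}addrC !(mxpowD _ _ A0).
exact: mulmx_sandwich.
Qed.

Lemma mxtrace_Gam A B s : posdef A ->
  \tr (Gam A s B) = \tr (B *m mxpow A s).
Proof.
move=> A0; rewrite /Gam -mulmxA mxtrace_mulC -mulmxA -(mxpowD _ _ A0) -splitr.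
by [].
Qed.

Lemma mxpow_eigmx U d s : U \is unitarymx ->
  mxpow (eigmx U d) s = eigmx U (\row_i d 0 i `^ s).
Proof.
move=> Uu; rewrite /mxpow (mxfun_eigmx _ _ Uu); apply: (congr1 (eigmx U)).
by apply/rowP=> i; rewrite !mxE.
Qed.

Lemma mxln_eigmx U d : U \is unitarymx ->
  mxln (eigmx U d) = eigmx U (\row_i ln (d 0 i)).
Proof.
move=> Uu; rewrite /mxln (mxfun_eigmx _ _ Uu); apply: (congr1 (eigmx U)).
by apply/rowP=> i; rewrite !mxE.
Qed.

(** The norm of [R[i]] takes real values in [R[i]]; [complex.Re] reads them in
    [R]. *)
Definition overlap U V i j : R := complex.Re `|(U *m V ^t*) i j| ^+ 2.

Lemma overlapE U V i j : (overlap U V i j)%:C = `|(U *m V ^t*) i j| ^+ 2.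
Proof.
rewrite /overlap rmorphXn; apply: (congr1 (fun z => z ^+ 2)).
exact: RRe_real (normr_real _).
Qed.

Lemma overlap_ge0 U V i j : 0 <= overlap U V i j.
Proof. exact: sqr_ge0. Qed.

Lemma sum_overlap U V i : U \is unitarymx -> V \is unitarymx ->
  \sum_j overlap U V i j = 1.
Proof.
move=> Uu Vu; apply: (@complexI R).
rewrite rmorph_sum rmorph1 -(sum_sqr_unitary i Uu Vu).
by apply: eq_bigr => j _; exact: overlapE.
Qed.

Lemma mxtrace_eigmx U d : U \is unitarymx ->
  \tr (eigmx U d) = (\sum_i d 0 i)%:C.
Proof.
move=> Uu; rewrite /eigmx mxtrace_udiag // rmorph_sum.
by apply: eq_bigr => i _; rewrite mxE.
Qed.

Lemma mxtrace_eigmxM U V d e :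
  \tr (eigmx U d *m eigmx V e)
  = (\sum_i \sum_j overlap U V i j * (d 0 i * e 0 j))%:C.
Proof.
rewrite /eigmx mxtrace_udiagM rmorph_sum; apply: eq_bigr => i _.
rewrite rmorph_sum; apply: eq_bigr => j _.
by rewrite [map_mx _ d 0 i]mxE [map_mx _ e 0 j]mxE -overlapE !rmorphM.
Qed.

Lemma mxtrace_eigmxMB U V d e f : U \is unitarymx -> V \is unitarymx ->
  \tr (eigmx U d *m (eigmx U e - eigmx V f))
  = (\sum_i \sum_j overlap U V i j * (d 0 i * (e 0 i - f 0 j)))%:C.
Proof.
move=> Uu Vu; rewrite /eigmx (mxtrace_udiagMB _ _ _ Uu Vu) rmorph_sum.
apply: eq_bigr => i _; rewrite rmorph_sum; apply: eq_bigr => j _.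
rewrite [map_mx _ d 0 i]mxE [map_mx _ e 0 i]mxE [map_mx _ f 0 j]mxE.
by rewrite -overlapE !rmorphM rmorphB.
Qed.

End FunctionalCalculus.

(** * Norms and entropy *)

Section Entropy.
Variables (R : realType) (n : nat) (sigma X : 'M[R[i]]_n) (p : R).
Hypotheses (n_gt0 : (0 < n)%N) (sigma_gt0 : posdef sigma) (X_gt0 : posdef X).
Hypothesis (p_gt0 : 0 < p).

Lemma normpE q : normp sigma q X =
  complex.Re (\tr (mxpow (Gam sigma q^-1 X) q)) `^ q^-1.
Proof. by rewrite /normp (mxabs_posdef (Gam_posdef _ sigma_gt0 X_gt0)). Qed.

(** [Gam sigma 1] is [Gam sigma p^-1] followed by [Gam sigma (1 - p^-1)], and
    cyclicity of the trace gathers the two outer powers of [sigma]. In this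
    form the 1-norm depends on [X] through [Gam sigma p^-1 X] alone, as the
    p-norm and the entropy do. *)
Lemma normp1E : normp sigma 1 X =
  complex.Re (\tr (Gam sigma p^-1 X *m mxpow sigma (1 - p^-1))) `^ 1.
Proof.
rewrite normpE invr1 (mxpow1 (Gam_posdef _ sigma_gt0 X_gt0)).
rewrite -[in Gam _ 1 _](subrKC p^-1 1) (GamD _ _ _ sigma_gt0).
apply: (congr1 (fun z => complex.Re z `^ 1)).
exact: mxtrace_Gam.
Qed.

(** Diagonalizing [Gam sigma p^-1 X] with eigenvalues [g] and [sigma] with
    eigenvalues [s], every trace becomes a sum weighted by the overlaps, and the
    claim becomes the classical inequality. *)
Lemma normp_sub_le_Ent :
  normp sigma p X `^ p - normp sigma 1 X `^ p <= (p - 1) * Ent sigma p X.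
Proof.
have pN0 : p != 0 by rewrite gt_eqF.
rewrite /Ent normp1E !normpE.
have [U [g [Uu -> g0]]] := posdef_eigmx (Gam_posdef p^-1 sigma_gt0 X_gt0).
have [V [s [Vu -> s0]]] := posdef_eigmx sigma_gt0.
rewrite !(mxpow_eigmx _ _ Uu) (mxpow_eigmx _ _ Vu).
rewrite (mxln_eigmx _ Uu) (mxln_eigmx _ Vu).
rewrite (mxtrace_eigmxMB _ _ _ Uu Vu) (mxtrace_eigmx _ Uu) mxtrace_eigmxM /=.
set y := \sum_i _; set Q := \sum_i _; set H := \sum_i _.
have yE : y = \sum_i g 0 i `^ p by apply: eq_bigr => i _; rewrite mxE.
have y0 : 0 < y.
  rewrite yE (bigD1 (Ordinal n_gt0)) //= ltr_wpDr ?powR_gt0 //.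
  by apply: sumr_ge0 => i _; apply: powR_ge0.
have QE : Q = \sum_i \sum_j overlap U V i j * (g 0 i * s 0 j `^ (1 - p^-1)).
  by apply: eq_bigr => i _; apply: eq_bigr => j _; rewrite mxE.
have Q0 : 0 <= Q.
  rewrite QE; apply: sumr_ge0 => i _; apply: sumr_ge0 => j _.
  by rewrite mulr_ge0 ?overlap_ge0 // mulr_ge0 ?powR_ge0 ?(ltW (g0 i)).
have HE : H = \sum_i \sum_j
    overlap U V i j * (g 0 i `^ p * (ln (g 0 i `^ p) - ln (s 0 j))).
  apply: eq_bigr => i _; apply: eq_bigr => j _.
  by apply: (congr1 ( *%R _)); rewrite !mxE.
rewrite -powRrM mulVf // !powRr1 ?(ltW y0) //.
move: y0; rewrite yE QE HE; apply: hellinger_relative_entropy => // i.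
  by move=> j; apply: overlap_ge0.
exact: sum_overlap.
Qed.

End Entropy.

Theorem proposition3p17 (R : realType) (n : nat)
    (P : R -> {linear 'M[R[i]]_n -> 'M[R[i]]_n})
    (L : {linear 'M[R[i]]_n -> 'M[R[i]]_n})
    (sigma : 'M[R[i]]_n) (p : R) :
  quantum_Markov_semigroup P ->
  is_generator P L ->
  primitive_with P sigma ->
  kms_detailed_balance sigma L ->
  0 < p -> p != 1 ->
  (1 < p -> (p%:E * alpha_opt sigma L p >= beta_opt sigma L p)%E) /\
  (p < 1 -> (p%:E * alpha_opt sigma L p <= beta_opt sigma L p)%E).
Proof.
move=> _ _ [[[sigma0 tr_sigma] _] _ rk_sigma] _ p0 p1.
have pN0 : p != 0 by rewrite gt_eqF.
(* The zero-dimensional space carries no state, as the trace is then 0. *)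
have n_gt0 : (0 < n)%N.
  rewrite lt0n; apply/eqP => nE; move/eqP: tr_sigma.
  by subst n; rewrite /mxtrace big_ord0 eq_sym oner_eq0.
have sigma_gt0 := possemidef_full_rank sigma0 rk_sigma.
have key X : posdef X -> _ := fun X0 => normp_sub_le_Ent n_gt0 sigma_gt0 X0 p0.
split=> [p_gt1|p_lt1].
  apply: ge_ereal_sup => _ [b [b0 lsb] <-].
  have -> : (b%:E = p%:E * (b / p)%:E)%E by rewrite -EFinM mulrC divfK.
  rewrite lee_pmul2l ?lte_fin //; apply: ereal_sup_ubound.
  exists (b / p) => //; split; first by rewrite divr_ge0 // ltW.
  move=> X X0; rewrite /hconj mulrA divfK //; apply: le_trans (lsb X X0).
  by rewrite -mulrA ler_wpM2l // ler_pdivrMl ?subr_gt0 // key.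
rewrite -lee_pdivlMl //; apply: ge_ereal_sup => _ [a [a0 bka] <-].
rewrite lee_pdivlMl // -EFinM; apply: ereal_sup_ubound.
exists (p * a) => //; split; first by rewrite mulr_ge0 // ltW.
move=> X X0; apply: le_trans (bka X X0).
have -> : a * hconj p = p * a / (p - 1) by rewrite /hconj mulrA [p * a]mulrC.
rewrite -[leRHS]mulrA ler_wpM2l ?mulr_ge0 // ?(ltW p0) //.
by rewrite ler_ndivlMl ?subr_lt0 // key.
Qed.
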